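(* Let $E$ be a propositional variable and $\delta$ a new atomic formula symbol. The logic $\mathsf{QLP}^-(\delta\leftrightarrow[(\exists x)x:\neg\delta\vee(E\wedge\neg(\exists x)x:(\delta\rightarrow E))])_{\emptyset}$, i.e. $\mathsf{QLP}^-$ without Axiom Necessitation, over the language extended by $\delta$, with this single additional axiom, is consistent.
   Context: Fix countably many justification variables, propositional variables, and primitive function symbols of each arity $n\ge0$; a primitive term is $f(x_1,\dots,x_n)$. Terms of $\mathsf{QLP}^-$: $t::= x\mid f(x_1,\dots,x_n)\mid t\cdot t\mid t+t\mid !t$. Formulas: $A::= p\mid\bot\mid\neg A\mid A\wedge A\mid A\vee A\mid A\rightarrow A\mid t:A\mid(\forall x)A\mid(\exists x)A$. Axioms: all propositional tautologies; Q1: $(\forall x)A(x)\rightarrow A(t)$, $t$ free for $x$; Q2: $(\forall x)(A\rightarrow B(x))\rightarrow(A\rightarrow(\forall x)B(x))$, $x$ not free in $A$; Q3: $A(t)\rightarrow(\exists x)A(x)$, $t$ free for $x$; Q4: $(\forall x)(A(x)\rightarrow B)\rightarrow((\exists x)A(x)\rightarrow B)$, $x$ not free in $B$; jK: $s:(A\rightarrow B)\rightarrow(t:A\rightarrow(s\cdot t):B)$; jT: $t:A\rightarrow A$; j4: $t:A\rightarrow !t:t:A$; Sum: $s:A\rightarrow(s+t):A$, $s:A\rightarrow(t+s):A$. Rules: Modus Ponens; Gen: from $A$ infer $(\forall x)A$; Axiom Necessitation: from an axiom instance $A$ infer $f(x_1,\dots,x_n):A$. The subscript $\emptyset$ means Axiom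 Necessitation is dropped. All schemes and rules apply to formulas of the extended language. *)

(* Defs.v *)
From mathcomp Require Import all_boot.

Set Implicit Arguments.
Unset Strict Implicit.
Unset Printing Implicit Defensive.

Definition jvar := nat.

(* [Prim f xs] is f(x_1,...,x_n): the n-place primitive function symbols are
   the pairs (n, f) with f : nat, and their arguments are variables only. *)
Inductive term : Type :=
| Var (x : jvar)
| Prim (n : nat) (f : nat) (xs : n.-tuple jvar)
| App (s t : term)
| Sum (s t : term)
| Bang (t : term).

(* [D] is the type of new atomic formula symbols added to the language; the
   original language is the case where [D] is empty. *)
Inductive formula (D : Type) : Type :=
| PVar (p : nat)
| New (d : D)
| Bot
| Neg (A : formula D)
| And (A B : formula D)
| Or (A B : formula D)
| Imp (A B : formula D)
| Just (t : term) (A : formula D)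
| All (x : jvar) (A : formula D)
| Ex (x : jvar) (A : formula D).

Arguments PVar {D} p.
Arguments New {D} d.
Arguments Bot {D}.

Definition Iff (D : Type) (A B : formula D) : formula D :=
  And (Imp A B) (Imp B A).

Fixpoint term_vars (t : term) : seq jvar :=
  match t with
  | Var x => [:: x]
  | Prim _ _ xs => xs
  | App s t | Sum s t => term_vars s ++ term_vars t
  | Bang t => term_vars t
  end.

Fixpoint free_vars (D : Type) (A : formula D) : seq jvar :=
  match A with
  | PVar _ | New _ | Bot => [::]
  | Neg A => free_vars A
  | And A B | Or A B | Imp A B => free_vars A ++ free_vars B
  | Just t A => term_vars t ++ free_vars A
  | All x A | Ex x A => [seq y <- free_vars A | y != x]
  end.

(* Replaces [x] by [t] in [s].  Since a primitive function symbol takes only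
   variables as arguments, the result is a term, and hence the substitution is
   defined, unless [x] occurs in a primitive term and [t] is not a variable. *)
Fixpoint subst_term (x : jvar) (t s : term) : option term :=
  match s with
  | Var y => Some (if y == x then t else Var y)
  | Prim n f xs =>
      if x \notin xs then Some (Prim f xs)
      else if t is Var z
           then Some (Prim f [tuple of [seq if y == x then z else y | y <- xs]])
           else None
  | App s1 s2 =>
      obind (fun r1 => omap (App r1) (subst_term x t s2)) (subst_term x t s1)
  | Sum s1 s2 =>
      obind (fun r1 => omap (Sum r1) (subst_term x t s2)) (subst_term x t s1)
  | Bang s => omap Bang (subst_term x t s)
  end.

(* [subst x t A] is A(t), the replacement of the free occurrences of [x] in [A]
   by [t], with no renaming of bound variables; it is [None] when the result is
   not a formula, for the reason given at [subst_term]. *)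
Fixpoint subst (D : Type) (x : jvar) (t : term) (A : formula D)
    : option (formula D) :=
  match A with
  | PVar _ | New _ | Bot => Some A
  | Neg A => omap (@Neg D) (subst x t A)
  | And A B => obind (fun A' => omap (And A') (subst x t B)) (subst x t A)
  | Or A B => obind (fun A' => omap (Or A') (subst x t B)) (subst x t A)
  | Imp A B => obind (fun A' => omap (Imp A') (subst x t B)) (subst x t A)
  | Just s A =>
      obind (fun s' => omap (Just s') (subst x t A)) (subst_term x t s)
  | All y A => if y == x then Some (All y A) else omap (All y) (subst x t A)
  | Ex y A => if y == x then Some (Ex y A) else omap (Ex y) (subst x t A)
  end.

Fixpoint free_for (D : Type) (t : term) (x : jvar) (A : formula D) : bool :=
  match A with
  | PVar _ | New _ | Bot => true
  | Neg A => free_for t x A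
  | And A B | Or A B | Imp A B => free_for t x A && free_for t x B
  | Just _ A => free_for t x A
  | All y B | Ex y B =>
      (x \notin free_vars A) || ((y \notin term_vars t) && free_for t x B)
  end.

(* [v] matters only on the formulas whose main symbol is not a propositional
   connective; these are the propositional atoms. *)
Fixpoint prop_eval (D : Type) (v : formula D -> bool) (A : formula D) : bool :=
  match A with
  | Bot => false
  | Neg A => ~~ prop_eval v A
  | And A B => prop_eval v A && prop_eval v B
  | Or A B => prop_eval v A || prop_eval v B
  | Imp A B => prop_eval v A ==> prop_eval v B
  | PVar _ | New _ | Just _ _ | All _ _ | Ex _ _ => v A
  end.

Definition tautology (D : Type) (A : formula D) : Prop :=
  forall v : formula D -> bool, prop_eval v A.

Inductive QLPm_axiom (D : Type) : formula D -> Prop :=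
| ax_taut A : tautology A -> QLPm_axiom A
| ax_Q1 x t A At : free_for t x A -> subst x t A = Some At ->
    QLPm_axiom (Imp (All x A) At)
| ax_Q2 x A B : x \notin free_vars A ->
    QLPm_axiom (Imp (All x (Imp A B)) (Imp A (All x B)))
| ax_Q3 x t A At : free_for t x A -> subst x t A = Some At ->
    QLPm_axiom (Imp At (Ex x A))
| ax_Q4 x A B : x \notin free_vars B ->
    QLPm_axiom (Imp (All x (Imp A B)) (Imp (Ex x A) B))
| ax_jK s t A B :
    QLPm_axiom (Imp (Just s (Imp A B)) (Imp (Just t A) (Just (App s t) B)))
| ax_jT t A : QLPm_axiom (Imp (Just t A) A)
| ax_j4 t A : QLPm_axiom (Imp (Just t A) (Just (Bang t) (Just t A)))
| ax_Suml s t A : QLPm_axiom (Imp (Just s A) (Just (Sum s t) A))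
| ax_Sumr s t A : QLPm_axiom (Imp (Just s A) (Just (Sum t s) A)).

(* Theorems of QLP^-(Phi)_∅, over the language extended by [D]: the formula
   [Phi] is an extra axiom and there is no Axiom Necessitation rule. *)
Inductive QLPm_empty (D : Type) (Phi : formula D) : formula D -> Prop :=
| thm_axiom A : QLPm_axiom A -> QLPm_empty Phi A
| thm_extra : QLPm_empty Phi Phi
| thm_MP A B : QLPm_empty Phi (Imp A B) -> QLPm_empty Phi A -> QLPm_empty Phi B
| thm_Gen x A : QLPm_empty Phi A -> QLPm_empty Phi (All x A).

Definition consistent (D : Type) (L : formula D -> Prop) : Prop := ~ L Bot.

(* Main.v *)
(* Without Axiom Necessitation no justification assertion [t : A] has to hold.
   Reading every [t : A] as false and every quantifier as vacuous validates all
   axioms and rules, whatever the truth values of the atoms.  The extra axiom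
   then says [delta <-> E], which holds when all atoms are true. *)

Require Import Defs.
From mathcomp Require Import all_boot.

Fixpoint truth (D : Type) (A : formula D) : bool :=
  match A with
  | PVar _ | New _ => true
  | Bot | Just _ _ => false
  | Neg A => ~~ truth D A
  | And A B => truth D A && truth D B
  | Or A B => truth D A || truth D B
  | Imp A B => truth D A ==> truth D B
  | All _ A | Ex _ A => truth D A
  end.
Arguments truth {D} A.

(** Lets [truth] itself serve as the valuation in [tautology], so that tautologies come out true. *)
Lemma prop_eval_truth (D : Type) (A : formula D) : prop_eval truth A = truth A.
Proof. by elim: A => //= [A -> | A -> B -> | A -> B -> | A -> B ->]. Qed.

(** Terms occur only in subformulas [Just s B], which are false whatever [s] and [B] are. *)
Lemma truth_subst (D : Type) x t (A A' : formula D) :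
  subst x t A = Some A' -> truth A' = truth A.
Proof.
elim: A A' => [p|d||A IHA|A IHA B IHB|A IHA B IHB|A IHA B IHB|s A IHA
  |y A IHA|y A IHA] A' /=.
- by case=> <-.
- by case=> <-.
- by case=> <-.
- by case: subst IHA => //= A1 /(_ _ erefl) eA [<-] /=; rewrite eA.
- case: subst IHA => //= A1 /(_ _ erefl) eA.
  by case: subst IHB => //= B1 /(_ _ erefl) eB [<-] /=; rewrite eA eB.
- case: subst IHA => //= A1 /(_ _ erefl) eA.
  by case: subst IHB => //= B1 /(_ _ erefl) eB [<-] /=; rewrite eA eB.
- case: subst IHA => //= A1 /(_ _ erefl) eA.
  by case: subst IHB => //= B1 /(_ _ erefl) eB [<-] /=; rewrite eA eB.
- by case: subst_term => //= s'; case: subst => //= A1 [<-].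
- by case: eqP => _; [case=> <- | case: subst IHA => //= A1 /(_ _ erefl) eA [<-]].
- by case: eqP => _; [case=> <- | case: subst IHA => //= A1 /(_ _ erefl) eA [<-]].
Qed.

Lemma truth_axiom (D : Type) (A : formula D) : QLPm_axiom A -> truth A.
Proof.
(* The justification axioms have a false antecedent and hold by computation. With quantifiers
   erased, Q1 to Q4 take the form [b ==> b]. *)
case=> //= [{}A tautA | x t {}A At _ /truth_subst -> | x {}A B _
  | x t {}A At _ /truth_subst -> | x {}A B _]; try exact: implybb.
by rewrite -prop_eval_truth; apply: tautA.
Qed.

Lemma truth_sound (D : Type) (Phi A : formula D) :
  truth Phi -> QLPm_empty Phi A -> truth A.
Proof.
move=> tPhi; elim=> {A} [A /truth_axiom // | // | A B _ /implyP AB _ /AB // |//].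
Qed.

Theorem theorem26 (E : nat) (x : jvar) :
  let delta : formula unit := New tt in
  consistent
    (QLPm_empty
       (Iff delta
          (Or (Ex x (Just (Var x) (Neg delta)))
              (And (PVar E)
                   (Neg (Ex x (Just (Var x) (Imp delta (PVar E))))))))).
(* The premise [truth Phi] computes to true: [delta] holds, and so does the second disjunct, as its
   existential formula is false. *)
Proof. by move=> delta thmBot; suff: truth (@Bot unit) by []; apply: truth_sound thmBot. Qed.
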